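(* Let $E$ be a propositional variable and $\delta$ a new atomic formula symbol (the fixed point operator of $A(p,E)=(\exists x)x:\neg p\vee(E\wedge\neg(\exists x)x:(p\rightarrow E))$). The logic $\mathsf{QLP}(\delta\leftrightarrow[(\exists x)x:\neg\delta\vee(E\wedge\neg(\exists x)x:(\delta\rightarrow E))])_{\emptyset}$, i.e. $\mathsf{QLP}$ without Axiom Necessitation, over the language extended by $\delta$, with this single additional axiom, is inconsistent.
   Context: Fix countably many justification variables, propositional variables, and primitive function symbols of each arity $n\ge0$; a primitive term is $f(x_1,\dots,x_n)$. Terms of $\mathsf{QLP}$: $t::= x\mid f(x_1,\dots,x_n)\mid t\cdot t\mid t+t\mid !t\mid(t\forall x)$ ($x$ bound in $(t\forall x)$). Formulas: $A::= p\mid\bot\mid\neg A\mid A\wedge A\mid A\vee A\mid A\rightarrow A\mid t:A\mid(\forall x)A\mid(\exists x)A$. Axioms: all propositional tautologies; Q1: $(\forall x)A(x)\rightarrow A(t)$, $t$ free for $x$; Q2: $(\forall x)(A\rightarrow B(x))\rightarrow(A\rightarrow(\forall x)B(x))$, $x$ not free in $A$; Q3: $A(t)\rightarrow(\exists x)A(x)$, $t$ free for $x$; Q4: $(\forall x)(A(x)\rightarrow B)\rightarrow((\exists x)A(x)\rightarrow B)$, $x$ not free in $B$; jK: $s:(A\rightarrow B)\rightarrow(t:A\rightarrow(s\cdot t):B)$; jT: $t:A\rightarrow A$; j4: $t:A\rightarrow !t:t:A$; Sum: $s:A\rightarrow(s+t):A$, $s:A\rightarrow(t+s):A$; UF: $(\exists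 y)y:(\forall x)t:A\rightarrow(t\forall x):(\forall x)A$, $y$ not free in $t$ or $A$. Rules: Modus Ponens; Gen: from $A$ infer $(\forall x)A$; qNec: from $A$ infer $(\exists x)x:A$, $x$ not free in $A$; Axiom Necessitation: from an axiom instance $A$ infer $f(x_1,\dots,x_n):A$. The subscript $\emptyset$ means Axiom Necessitation is dropped. All schemes and rules apply to formulas of the extended language. *)

(* Defs.v *)
From mathcomp Require Import all_boot.

Set Implicit Arguments.
Unset Strict Implicit.
Unset Printing Implicit Defensive.

Definition jvar := nat.
Definition pvar := nat.

(* [TPrim n i xs] is f(x_1, ..., x_n), with f the i-th primitive function
   symbol of arity n; the arguments are variables, not arbitrary terms.
   [TAll t x] is (t forall x). *)
Inductive term : Type :=
  | TVar of jvar
  | TPrim n (i : nat) (xs : n.-tuple jvar)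
  | TApp of term & term
  | TSum of term & term
  | TBang of term
  | TAll of term & jvar.

(* [P] is the type of atomic formulas: [pvar] for the language of QLP itself,
   a larger type for its extensions by new atomic formulas. *)
Inductive form (P : Type) : Type :=
  | FAtom of P
  | FBot
  | FNeg of form P
  | FAnd of form P & form P
  | FOr of form P & form P
  | FImp of form P & form P
  | FJust of term & form P
  | FAll of jvar & form P
  | FEx of jvar & form P.

Arguments FBot {P}.

Declare Scope qlp_scope.
Delimit Scope qlp_scope with qlp.
Bind Scope qlp_scope with form.
Notation "A --> B" := (FImp A B)
  (at level 70, right associativity) : qlp_scope.
Notation "A \/ B" := (FOr A B) : qlp_scope.
Notation "A /\ B" := (FAnd A B) : qlp_scope.
Notation "~ A" := (FNeg A) : qlp_scope.
Notation "t :; A" := (FJust t A)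
  (at level 60, right associativity) : qlp_scope.
Notation "A <--> B" := (FAnd (FImp A B) (FImp B A))
  (at level 95, no associativity) : qlp_scope.
Local Open Scope qlp_scope.

Fixpoint tfree (x : jvar) (t : term) : bool :=
  match t with
  | TVar y => x == y
  | TPrim _ _ xs => x \in val xs
  | TApp s t | TSum s t => tfree x s || tfree x t
  | TBang t => tfree x t
  | TAll t y => (x != y) && tfree x t
  end.

Fixpoint ffree P (x : jvar) (A : form P) : bool :=
  match A with
  | FAtom _ | FBot => false
  | FNeg A => ffree x A
  | FAnd A B | FOr A B | FImp A B => ffree x A || ffree x B
  | FJust t A => tfree x t || ffree x A
  | FAll y A | FEx y A => (x != y) && ffree x A
  end.

Definition is_var (t : term) : bool := if t is TVar _ then true else false.

Definition rename_arg (x : jvar) (s : term) (y : jvar) : jvar :=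
  if y == x then (if s is TVar z then z else y) else y.

(* [tsubst x s t] replaces the free occurrences of x in t by s.  Replacing an
   argument of a primitive term by a non-variable does not yield a term; the
   value of [rename_arg] in that case is a dummy, excluded by [tfree_for] and
   [free_for] below. *)
Fixpoint tsubst (x : jvar) (s : term) (t : term) : term :=
  match t with
  | TVar y => if y == x then s else t
  | TPrim n i xs => TPrim i (map_tuple (rename_arg x s) xs)
  | TApp t1 t2 => TApp (tsubst x s t1) (tsubst x s t2)
  | TSum t1 t2 => TSum (tsubst x s t1) (tsubst x s t2)
  | TBang t1 => TBang (tsubst x s t1)
  | TAll t1 y => if y == x then t else TAll (tsubst x s t1) y
  end.

Fixpoint subst P (x : jvar) (s : term) (A : form P) : form P :=
  match A with
  | FAtom _ | FBot => A
  | FNeg B => FNeg (subst x s B)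
  | FAnd B C => FAnd (subst x s B) (subst x s C)
  | FOr B C => FOr (subst x s B) (subst x s C)
  | FImp B C => FImp (subst x s B) (subst x s C)
  | FJust t B => FJust (tsubst x s t) (subst x s B)
  | FAll y B => if y == x then A else FAll y (subst x s B)
  | FEx y B => if y == x then A else FEx y (subst x s B)
  end.

Fixpoint tfree_for (s : term) (x : jvar) (t : term) : bool :=
  match t with
  | TVar _ => true
  | TPrim _ _ xs => (x \in val xs) ==> is_var s
  | TApp t1 t2 | TSum t1 t2 => tfree_for s x t1 && tfree_for s x t2
  | TBang t1 => tfree_for s x t1
  | TAll t1 y => tfree x t ==> ~~ tfree y s && tfree_for s x t1
  end.

Fixpoint free_for P (s : term) (x : jvar) (A : form P) : bool :=
  match A with
  | FAtom _ | FBot => true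
  | FNeg B => free_for s x B
  | FAnd B C | FOr B C | FImp B C => free_for s x B && free_for s x C
  | FJust t B => tfree_for s x t && free_for s x B
  | FAll y B | FEx y B => ffree x A ==> ~~ tfree y s && free_for s x B
  end.

(* Atomic, justification and quantified formulas are propositional atoms. *)
Fixpoint prop_eval P (v : form P -> bool) (A : form P) : bool :=
  match A with
  | FBot => false
  | FNeg B => ~~ prop_eval v B
  | FAnd B C => prop_eval v B && prop_eval v C
  | FOr B C => prop_eval v B || prop_eval v C
  | FImp B C => prop_eval v B ==> prop_eval v C
  | FAtom _ | FJust _ _ | FAll _ _ | FEx _ _ => v A
  end.

Definition tautology P (A : form P) : Prop := forall v, prop_eval v A.

Inductive qlp_axiom P : form P -> Prop :=
  | ax_taut A : tautology A -> qlp_axiom A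
  | ax_Q1 x t A : free_for t x A -> qlp_axiom (FAll x A --> subst x t A)
  | ax_Q2 x A B : ~~ ffree x A ->
      qlp_axiom (FAll x (A --> B) --> (A --> FAll x B))
  | ax_Q3 x t A : free_for t x A -> qlp_axiom (subst x t A --> FEx x A)
  | ax_Q4 x A B : ~~ ffree x B ->
      qlp_axiom (FAll x (A --> B) --> (FEx x A --> B))
  | ax_jK s t A B :
      qlp_axiom (s :; (A --> B) --> (t :; A --> TApp s t :; B))
  | ax_jT t A : qlp_axiom (t :; A --> A)
  | ax_j4 t A : qlp_axiom (t :; A --> TBang t :; t :; A)
  | ax_SumL s t A : qlp_axiom (s :; A --> TSum s t :; A)
  | ax_SumR s t A : qlp_axiom (s :; A --> TSum t s :; A)
  | ax_UF x y t A : ~~ tfree y t -> ~~ ffree y A ->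
      qlp_axiom (FEx y (TVar y :; FAll x (t :; A)) --> TAll t x :; FAll x A).

(* Theorems of QLP with additional axioms [X] and without Axiom
   Necessitation. *)
Inductive qlp_empty P (X : form P -> Prop) : form P -> Prop :=
  | qlp_ax A : qlp_axiom A -> qlp_empty X A
  | qlp_extra A : X A -> qlp_empty X A
  | qlp_MP A B : qlp_empty X (A --> B) -> qlp_empty X A -> qlp_empty X B
  | qlp_Gen x A : qlp_empty X A -> qlp_empty X (FAll x A)
  | qlp_qNec x A : ~~ ffree x A -> qlp_empty X A ->
      qlp_empty X (FEx x (TVar x :; A)).

Definition inconsistent P (L : form P -> Prop) : Prop := L FBot.

Inductive delta_atom : Type :=
  | PVar of pvar
  | Delta.

Definition delta : form delta_atom := FAtom Delta.

Definition fixpoint_formula P (x : jvar) (p E : form P) : form P :=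
  FEx x (TVar x :; ~ p) \/ (E /\ ~ FEx x (TVar x :; (p --> E))).

Definition delta_axiom (x : jvar) (E : pvar) : form delta_atom :=
  delta <--> fixpoint_formula x delta (FAtom (PVar E)).

(* QLP(delta <-> A(delta, E)) without Axiom Necessitation, with x the bound
   variable of A. *)
Definition qlp_delta_empty (x : jvar) (E : pvar) : form delta_atom -> Prop :=
  qlp_empty (eq (delta_axiom x E)).

(* Main.v *)
(* Write K A for [(exists x) x : A].  By jT, [K ~ delta] implies [~ delta],
   while the fixed point axiom makes it imply [delta].  Hence [delta] reduces to
   [E /\ ~ K (delta --> E)], so [delta --> E] is a theorem and qNec gives
   [K (delta --> E)].  This refutes [delta], qNec then gives [K ~ delta], and
   [delta] follows. *)

Require Import Defs.
From mathcomp Require Import all_boot.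

Local Open Scope qlp_scope.

(** Quantified formulas count as propositional atoms, so finitely many values of [v] decide the
    goal. *)
Ltac taut_cases v :=
  repeat match goal with |- context [v ?A] => case: (v A) end.

Lemma qlp_taut P (X : form P -> Prop) (A : form P) :
  tautology A -> qlp_empty X A.
Proof. by move=> tA; apply/qlp_ax/ax_taut. Qed.

(** Gen applied to jT yields the premise of Q4 with conclusion [A]. *)
Lemma qlp_exT P (X : form P -> Prop) x (A : form P) :
  ~~ ffree x A -> qlp_empty X (FEx x (TVar x :; A) --> A).
Proof.
move=> xA; apply: qlp_MP; first exact/qlp_ax/ax_Q4.
exact/qlp_Gen/qlp_ax/ax_jT.
Qed.

Theorem theorem25 (x : jvar) (E : pvar) : inconsistent (qlp_delta_empty x E).
Proof.
have fix_d : qlp_delta_empty x E (delta_axiom x E) by exact: qlp_extra.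
(* Atoms have no free variables, so the side conditions here and for qNec hold by computation. *)
have factive : qlp_delta_empty x E (FEx x (TVar x :; ~ delta) --> ~ delta).
  exact: qlp_exT.
have d_imp_E : qlp_delta_empty x E (delta --> FAtom (PVar E)).
  apply: qlp_MP factive; apply: qlp_MP fix_d; apply: qlp_taut => v /=.
  by taut_cases v.
have known_d_imp_E : qlp_delta_empty x E
    (FEx x (TVar x :; (delta --> FAtom (PVar E)))) by exact: qlp_qNec.
have not_d : qlp_delta_empty x E (~ delta).
  (* Under [delta], [factive] excludes the first disjunct and [known_d_imp_E] the second. *)
  apply: qlp_MP known_d_imp_E; apply: qlp_MP factive; apply: qlp_MP fix_d.
  by apply: qlp_taut => v /=; taut_cases v.
have known_not_d : qlp_delta_empty x E (FEx x (TVar x :; ~ delta)).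
  exact: qlp_qNec.
(* Only here is the right-to-left half of [delta_axiom] used. *)
apply: qlp_MP known_not_d; apply: qlp_MP not_d; apply: qlp_MP fix_d.
by apply: qlp_taut => v /=; taut_cases v.
Qed.
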